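(* The curve-shortening flow (mean curvature flow of simple closed plane curves) is not a gradient flow on $\mathcal{C}_2$ in either of the following two Riemannian structures. (1) (Shi–Vorotnikov structure.) There is no functional $\mathcal{F}:\mathcal{C}_2\to\mathbb{R}$ whose gradient flow with respect to the uniformness-preserving inner product $(\cdot,\cdot)_N$ is the curve-shortening flow. That is, there is no $\mathcal{F}:\mathcal{C}_2\to\mathbb{R}$ such that for every smooth path $(\Gamma_t)_{t\in[0,1]}$ in $\mathcal{C}_2$ with normal velocity $\vec V_t^{\bot}$, the function $t\mapsto\mathcal{F}(\Gamma_t)$ is differentiable with $$\frac{d}{dt}\mathcal{F}(\Gamma_t)=-\big(P_{\Gamma_t}(\vec H_t),P_{\Gamma_t}(\vec V_t^{\bot})\big)_N .$$ (2) (Michor–Mumford structure.) There is no functional $\mathcal{F}:\mathcal{C}_2\to\mathbb{R}$ whose gradient flow with respect to the curvature-weighted inner product $(\cdot,\cdot)_M$ is the curve-shortening flow. That is, there is no $\mathcal{F}:\mathcal{C}_2\to\mathbb{R}$ such that for every smooth path $(\Gamma_t)_{t\in[0,1]}$ in $\mathcal{C}_2$ with normal velocity $\vec V_t^{\bot}$, the function $t\mapsto\mathcal{F}(\Gamma_t)$ is differentiable with $$\frac{d}{dt}\mathcal{F}(\Gamma_t)=-\big(\vec H_t,\vec V_t^{\bot}\big)_M .$$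
   Context: $\mathcal{C}_2$ is the set of smooth embeddings $\mathbb{S}^1\to\mathbb{R}^2$ modulo the relation identifying two embeddings with the same image; an element is identified with its image, a smooth simple closed curve $\Gamma\subset\mathbb{R}^2$. $\mathcal{H}^1$ is one-dimensional Hausdorff measure. A smooth path in $\mathcal{C}_2$ is a family $\Gamma_t=\Phi(t,\mathbb{S}^1)$, $t\in[0,1]$, with $\Phi:[0,1]\times\mathbb{S}^1\to\mathbb{R}^2$ smooth and each $\Phi(t,\cdot)$ an embedding. Its normal velocity $\vec V_t^{\bot}$ is the normal component along $\Gamma_t$ of the velocity $\partial_t\Phi$, viewed as a vector field on $\Gamma_t$. $\vec H=\kappa\vec N$ is the curvature vector of $\Gamma$ (the second derivative of an arc-length parametrization), $\kappa$ is the scalar curvature, and $\vec H_t$ is the curvature vector of $\Gamma_t$. The curve-shortening flow is the evolution with normal velocity $\vec V_t^{\bot}=\vec H_t$. Structure (1): For a curve $\Gamma$, write $\int f\,d\Gamma=\frac{1}{\mathcal{H}^1(\Gamma)}\int_\Gamma f\,d\mathcal{H}^1$. Tangent vectors at $\Gamma$ are vector fields $\vec V$ on $\Gamma$ (with normal and tangential components) whose tangential divergence $\mathrm{div}_\Gamma\vec V$ is constant on $\Gamma$, with inner product $(\vec V,\vec W)_N=\int\vec V\cdot\vec W\,d\Gamma$. A normal field $\vec V^{\bot}$ is represented in this tangent space by $P_\Gamma(\vec V^{\bot})=\vec V^{\bot}+\nabla_\Gamma U$, where $U:\Gamma\to\mathbb{R}$ is the unique solution of $-\Delta_\Gamma U=\int\vec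 V^{\bot}\cdot\vec H\,d\Gamma-\vec V^{\bot}\cdot\vec H$ with $\int U\,d\Gamma=0$. Here $\nabla_\Gamma,\Delta_\Gamma$ are the tangential gradient and Laplacian on $\Gamma$ (first derivative along the unit tangent, times the unit tangent; second derivative in arc length). In this structure the curve-shortening flow is the flow of the vector field $\Gamma\mapsto P_\Gamma(\vec H_\Gamma)$ on $\mathcal{C}_2$. Structure (2): Tangent vectors at $\Gamma$ are the normal vector fields on $\Gamma$, with inner product $(\vec V^{\bot},\vec W^{\bot})_M=\int_\Gamma(1+\kappa^2)\,\vec V^{\bot}\cdot\vec W^{\bot}\,d\mathcal{H}^1$. In this structure the curve-shortening flow is the flow of the vector field $\Gamma\mapsto\vec H_\Gamma$. A flow of a vector field $X$ on $\mathcal{C}_2$ is a gradient flow of $\mathcal{F}$ if $X=-\nabla\mathcal{F}$ for the given inner product, i.e. the derivative of $\mathcal{F}$ along any smooth path is minus the inner product of $X$ with the velocity of the path. *)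

(* Defs.v *)
From Stdlib Require Import Reals ClassicalEpsilon.
From Coquelicot Require Import Coquelicot.
Open Scope R_scope.

(** The circle is R / 2 pi Z: a map on the circle is a 2 pi-periodic map on R. *)

Definition plane : Type := (R * R)%type.

Definition dot (v w : plane) : R := fst v * fst w + snd v * snd w.
Definition scale (a : R) (v : plane) : plane := (a * fst v, a * snd v).
Definition add (v w : plane) : plane := (fst v + fst w, snd v + snd w).
Definition rot90 (v : plane) : plane := (- snd v, fst v).

Definition periodic {A : Type} (f : R -> A) : Prop :=
  forall x, f (x + 2 * PI) = f x.

Definition smooth (f : R -> R) : Prop := forall n x, ex_derive_n f n x.

Definition smooth2 (f : R -> R -> R) : Prop := forall n x y, ex_diff_n f n x y.

Definition plane_derive (g : R -> plane) (x : R) : plane :=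
  (Derive (fun y => fst (g y)) x, Derive (fun y => snd (g y)) x).

(** As the circle is compact, an embedding is an injective immersion. *)
Record embedding (g : R -> plane) : Prop := {
  emb_smooth_fst : smooth (fun x => fst (g x));
  emb_smooth_snd : smooth (fun x => snd (g x));
  emb_periodic : periodic g;
  emb_injective : forall x y, 0 <= x < 2 * PI -> 0 <= y < 2 * PI ->
    g x = g y -> x = y;
  emb_immersion : forall x, plane_derive g x <> (0, 0)
}.

Definition is_image (G : plane -> Prop) (g : R -> plane) : Prop :=
  forall p, G p <-> exists x, g x = p.

(** Embeddings modulo equality of images. *)
Definition C2 : Type :=
  {G : plane -> Prop | exists g, embedding g /\ is_image G g}.

(** [Phi] is a smooth extension to R x R of the map on [0,1] x S^1; only the
    times in [0,1] matter, and on [0,1] the time derivative does not depend on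
    the choice of the extension. *)
Record smooth_path (Gamma : R -> C2) (Phi : R -> R -> plane) : Prop := {
  path_smooth_fst : smooth2 (fun t x => fst (Phi t x));
  path_smooth_snd : smooth2 (fun t x => snd (Phi t x));
  path_embedding : forall t, 0 <= t <= 1 -> embedding (Phi t);
  path_image : forall t, 0 <= t <= 1 -> is_image (proj1_sig (Gamma t)) (Phi t)
}.

(** In the following a curve is given by an embedding [g] of the circle, and a
    function or vector field [f] on it by its pullback [x |-> f (g x)]. All the
    quantities below are independent of the choice of [g]. *)

Definition speed (g : R -> plane) (x : R) : R :=
  sqrt (dot (plane_derive g x) (plane_derive g x)).

(** Derivatives with respect to arc length. *)
Definition ds (g : R -> plane) (f : R -> R) (x : R) : R := Derive f x / speed g x.
Definition plane_ds (g : R -> plane) (f : R -> plane) (x : R) : plane :=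
  scale (/ speed g x) (plane_derive f x).

Definition tangent (g : R -> plane) : R -> plane := plane_ds g g.
Definition normal (g : R -> plane) (x : R) : plane := rot90 (tangent g x).

Definition curvature_vector (g : R -> plane) : R -> plane :=
  plane_ds g (plane_ds g g).
Definition curvature (g : R -> plane) (x : R) : R :=
  dot (curvature_vector g x) (normal g x).

(** Integral with respect to one-dimensional Hausdorff measure on the curve,
    which on an embedded smooth curve is the arc length measure |g'(x)| dx. *)
Definition curve_int (g : R -> plane) (f : R -> R) : R :=
  RInt (fun x => f x * speed g x) 0 (2 * PI).

Definition curve_mean (g : R -> plane) (f : R -> R) : R :=
  curve_int g f / curve_int g (fun _ => 1).

Definition tangential_gradient (g : R -> plane) (U : R -> R) (x : R) : plane :=
  scale (ds g U x) (tangent g x).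
Definition tangential_laplacian (g : R -> plane) (U : R -> R) : R -> R :=
  ds g (ds g U).

Definition normal_velocity (Phi : R -> R -> plane) (t x : R) : plane :=
  let n := normal (Phi t) x in
  scale (dot (plane_derive (fun s => Phi s x) t) n) n.

Definition inner_N (g : R -> plane) (V W : R -> plane) : R :=
  curve_mean g (fun x => dot (V x) (W x)).

Record potential_spec (g : R -> plane) (V : R -> plane) (U : R -> R) : Prop := {
  pot_periodic : periodic U;
  pot_ex_derive : forall x, ex_derive U x;
  pot_ex_derive2 : forall x, ex_derive (ds g U) x;
  pot_eq : forall x, - tangential_laplacian g U x =
    curve_mean g (fun y => dot (V y) (curvature_vector g y))
    - dot (V x) (curvature_vector g x);
  pot_mean : curve_mean g U = 0
}.

(** The unique solution: for a smooth periodic field [V] along an embedding [g],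
    exactly one function satisfies [potential_spec g V]. *)
Definition potential (g : R -> plane) (V : R -> plane) : R -> R :=
  epsilon (inhabits (fun _ => 0)) (potential_spec g V).

(** The representative of the normal field [V]; its tangential divergence is the
    constant minus the mean of V . H. *)
Definition P (g : R -> plane) (V : R -> plane) (x : R) : plane :=
  add (V x) (tangential_gradient g (potential g V) x).

Definition inner_M (g : R -> plane) (V W : R -> plane) : R :=
  curve_int g (fun x => (1 + curvature g x ^ 2) * dot (V x) (W x)).

(** [X] is the vector field, [rep] maps the normal velocity of a path to the
    tangent vector representing it, and [inner] is the inner product. [D_in]
    is the derivative within [0,1], one-sided at the endpoints. *)
Definition is_minus_gradient
    (inner : (R -> plane) -> (R -> plane) -> (R -> plane) -> R)
    (rep : (R -> plane) -> (R -> plane) -> R -> plane)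
    (X : (R -> plane) -> R -> plane) (F : C2 -> R) : Prop :=
  forall (Gamma : R -> C2) (Phi : R -> R -> plane), smooth_path Gamma Phi ->
  forall t, 0 <= t <= 1 ->
  D_in (fun s => F (Gamma s))
       (fun s => - inner (Phi s) (X (Phi s)) (rep (Phi s) (normal_velocity Phi s)))
       (fun s => 0 <= s <= 1) t.

(* Main.v *)
Require Import Defs.
From Stdlib Require Import Reals Lra ProofIrrelevance FunctionalExtensionality ClassicalEpsilon.
From Coquelicot Require Import Coquelicot.
Open Scope R_scope.

(** Both structures are invariant under rotations of the plane. If the
    curve-shortening field [X] were [-grad F], then along a full turn of a curve
    about the origin the derivative of [F] would be minus the inner product of [X]
    with the rotation field, hence constant by invariance; as a full turn is a
    closed loop in [C2], this constant is zero
    ([gradient_orthogonal_to_turning]). So it suffices to find one curve for which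
    [X] is not orthogonal to the rotation field.

    Take a convex curve with support function [h] of the tangent angle. It has
    radius of curvature [rho = h + h''], the element of arc length is [rho dx], and
    the rotation has normal velocity [h'] (times the angular speed). For structure
    (2) the inner product is the integral of [h' (1 + 1 / rho^2)]
    ([inner_M_turning]). For structure (1), an integration by parts eliminates the
    potentials, and up to a nonzero factor the inner product is the integral of
    [Q / rho], where [Q] is the periodic primitive of [rho (h - k)] that is
    orthogonal to [rho] ([inner_N_turning]).

    Expanded in the deviation from the unit circle, both integrals start with
    cubic terms, which are nonzero for a combination of [cos 2x] and [sin 4x]. For
    [h = 1 + (5 cos 2x + sin 4x) / 1000] the cubic part dominates the remainder, so
    that neither integral is zero ([oval_M_integral_neq_0],
    [oval_N_integral_neq_0]), and the same oval settles both structures. *)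

(** * Smooth functions of two variables *)

Lemma ex_diff_n_succ (f ft fx : R -> R -> R) (n : nat) :
  (forall t x, continuity_2d_pt f t x) ->
  (forall t x, is_derive (fun s => f s x) t (ft t x)) ->
  (forall t x, is_derive (fun y => f t y) x (fx t x)) ->
  (forall t x, ex_diff_n ft n t x) -> (forall t x, ex_diff_n fx n t x) ->
  forall t x, ex_diff_n f (S n) t x.
Proof.
  intros Hc Ht Hx Dt Dx t x. simpl. split; [apply Hc|].
  split; [eexists; apply Ht|]. split; [eexists; apply Hx|].
  split.
  - replace (fun u v => Derive (fun z => f z v) u) with ft; [apply Dt|].
    do 2 (apply functional_extensionality; intro). symmetry; apply is_derive_unique, Ht.
  - replace (fun u v => Derive (fun z => f u z) v) with fx; [apply Dx|].
    do 2 (apply functional_extensionality; intro). symmetry; apply is_derive_unique, Hx.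
Qed.

Definition dt (f : R -> R -> R) (t x : R) : R := Derive (fun s => f s x) t.
Definition dx (f : R -> R -> R) (t x : R) : R := Derive (fun y => f t y) x.

Lemma ex_diff_n_pred (f : R -> R -> R) (n : nat) :
  (forall t x, ex_diff_n f (S n) t x) ->
  (forall t x, continuity_2d_pt f t x) /\
  (forall t x, is_derive (fun s => f s x) t (dt f t x)) /\
  (forall t x, is_derive (fun y => f t y) x (dx f t x)) /\
  (forall t x, ex_diff_n (dt f) n t x) /\ (forall t x, ex_diff_n (dx f) n t x).
Proof.
  intros H. refine (conj _ (conj _ (conj _ (conj _ _))));
    intros t x; destruct (H t x) as (Hc & Ht & Hx & Dt & Dx);
    try assumption.
  - now apply Derive_correct.
  - now apply Derive_correct.
Qed.

(** The induction on the order has to treat all functions at once, because it is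
    applied to their partial derivatives. *)
Lemma ex_diff_n_plus (n : nat) : forall f g : R -> R -> R,
  (forall t x, ex_diff_n f n t x) -> (forall t x, ex_diff_n g n t x) ->
  forall t x, ex_diff_n (fun t x => f t x + g t x) n t x.
Proof.
  induction n as [|n IH]; intros f g Hf Hg.
  - intros t x; split; [|exact I]. apply continuity_2d_pt_plus; [apply Hf|apply Hg].
  - apply ex_diff_n_pred in Hf as (cf & tf & xf & Dtf & Dxf).
    apply ex_diff_n_pred in Hg as (cg & tg & xg & Dtg & Dxg).
    apply (ex_diff_n_succ _ (fun t x => dt f t x + dt g t x) (fun t x => dx f t x + dx g t x)).
    + intros; now apply continuity_2d_pt_plus.
    + intros t x. exact (is_derive_plus (fun s => f s x) (fun s => g s x) t _ _
        (tf t x) (tg t x)).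
    + intros t x. exact (is_derive_plus (fun s => f t s) (fun s => g t s) x _ _
        (xf t x) (xg t x)).
    + now apply IH.
    + now apply IH.
Qed.

Lemma ex_diff_n_mult (n : nat) : forall f g : R -> R -> R,
  (forall t x, ex_diff_n f n t x) -> (forall t x, ex_diff_n g n t x) ->
  forall t x, ex_diff_n (fun t x => f t x * g t x) n t x.
Proof.
  induction n as [|n IH]; intros f g Hf Hg.
  - intros t x; split; [|exact I]. apply continuity_2d_pt_mult; [apply Hf|apply Hg].
  - (* the product rule contains the undifferentiated factors, one order lower *)
    assert (Hf' : forall t x, ex_diff_n f n t x) by (intros; apply (ex_diff_n_m (S n)); auto).
    assert (Hg' : forall t x, ex_diff_n g n t x) by (intros; apply (ex_diff_n_m (S n)); auto).
    apply ex_diff_n_pred in Hf as (cf & tf & xf & Dtf & Dxf).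
    apply ex_diff_n_pred in Hg as (cg & tg & xg & Dtg & Dxg).
    apply (ex_diff_n_succ _ (fun t x => dt f t x * g t x + f t x * dt g t x)
                           (fun t x => dx f t x * g t x + f t x * dx g t x)).
    + intros; now apply continuity_2d_pt_mult.
    + intros t x. exact (is_derive_mult (fun s => f s x) (fun s => g s x) t _ _
        (tf t x) (tg t x) Rmult_comm).
    + intros t x. exact (is_derive_mult (fun s => f t s) (fun s => g t s) x _ _
        (xf t x) (xg t x) Rmult_comm).
    + apply ex_diff_n_plus; now apply IH.
    + apply ex_diff_n_plus; now apply IH.
Qed.

Lemma smooth2_plus (f g : R -> R -> R) :
  smooth2 f -> smooth2 g -> smooth2 (fun t x => f t x + g t x).
Proof. intros Hf Hg n. apply ex_diff_n_plus; intros; [apply Hf|apply Hg]. Qed.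

Lemma smooth2_mult (f g : R -> R -> R) :
  smooth2 f -> smooth2 g -> smooth2 (fun t x => f t x * g t x).
Proof. intros Hf Hg n. apply ex_diff_n_mult; intros; [apply Hf|apply Hg]. Qed.

Lemma smooth2_const (k : R) : smooth2 (fun _ _ => k).
Proof.
  intros n; revert k. induction n as [|n IH]; intros k.
  - intros t x; split; [|exact I]. apply continuity_2d_pt_const.
  - apply (ex_diff_n_succ _ (fun _ _ => 0) (fun _ _ => 0)).
    + intros; apply continuity_2d_pt_const.
    + intros; apply (is_derive_const k).
    + intros; apply (is_derive_const k).
    + apply IH.
    + apply IH.
Qed.

(** A phase shift by a quarter period turns every partial derivative into a
    multiple of a function of the same form, so one induction covers all orders. *)
Lemma smooth2_sin_affine (a b c : R) : smooth2 (fun t x => sin (a * t + b * x + c)).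
Proof.
  intros n; revert c. induction n as [|n IH]; intros c.
  all: assert (Hc : forall t x, continuity_2d_pt (fun t x => sin (a * t + b * x + c)) t x).
  1,3: intros t x; apply (continuity_1d_2d_pt_comp sin (fun t x => a * t + b * x + c));
    [apply continuity_sin|];
    repeat (apply continuity_2d_pt_plus || apply continuity_2d_pt_mult ||
      apply continuity_2d_pt_const || apply continuity_2d_pt_id1 || apply continuity_2d_pt_id2).
  - intros t x; split; [apply Hc|exact I].
  - assert (Hk : forall k t x, ex_diff_n (fun t x => k * sin (a * t + b * x + (c + PI / 2))) n t x)
      by (intros k; apply ex_diff_n_mult; [intros; apply smooth2_const | apply IH]).
    apply (ex_diff_n_succ _ (fun t x => a * sin (a * t + b * x + (c + PI / 2)))
                           (fun t x => b * sin (a * t + b * x + (c + PI / 2)))); auto.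
    all: intros t x; rewrite <- (Rplus_assoc _ c), (Rplus_comm _ (PI / 2)), <- cos_sin;
      auto_derive; [exact I | ring].
Qed.

Lemma smooth2_cos_affine (a b c : R) : smooth2 (fun t x => cos (a * t + b * x + c)).
Proof.
  replace (fun t x => cos (a * t + b * x + c))
    with (fun t x => sin (a * t + b * x + (c + PI / 2))); [apply smooth2_sin_affine|].
  do 2 (apply functional_extensionality; intro).
  now rewrite <- (Rplus_assoc _ c), (Rplus_comm _ (PI / 2)), <- cos_sin.
Qed.

(** The iterated [x]-derivative of [f t] is the slice at [t] of an iterated
    partial derivative of [f], which is again smooth. *)
Lemma smooth2_slice (f : R -> R -> R) (t : R) : smooth2 f -> smooth (f t).
Proof.
  intros Hf.
  assert (H : forall n, exists g, smooth2 g /\ forall x, Derive_n (f t) n x = g t x).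
  { induction n as [|n (g & Hg & E)].
    - now exists f.
    - exists (dx g); split.
      + intros m t' x. apply (ex_diff_n_pred g m). intros; apply Hg.
      + intros x. simpl. now apply Derive_ext. }
  intros [|n] x; simpl; [exact I|].
  destruct (H n) as (g & Hg & E).
  apply (ex_derive_ext (g t)); [intros; symmetry; apply E|].
  destruct (Hg 1%nat t x) as (_ & _ & Hx & _). exact Hx.
Qed.

(** * Periodic functions and their integrals *)

(** [RInt] on real functions yields equations whose type is a Coquelicot
    structure over [R], which [ring] and [field] do not recognise. *)
Ltac real_eq := match goal with |- @eq _ ?a ?b => change (@eq R a b) end.

Lemma continuous_Rplus (f g : R -> R) (x : R) :
  continuous f x -> continuous g x -> continuous (fun y => f y + g y) x.
Proof. exact (continuous_plus f g x). Qed.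

Lemma continuous_Rmult (f g : R -> R) (x : R) :
  continuous f x -> continuous g x -> continuous (fun y => f y * g y) x.
Proof. exact (continuous_mult f g x). Qed.

Ltac continuity :=
  intros; unfold Rminus;
  repeat match goal with
  | |- continuous (fun _ => ?k) _ => apply continuous_const
  | |- continuous (fun y => @?f y + @?g y) _ => apply (continuous_Rplus f g)
  | |- continuous (fun y => @?f y * @?g y) _ => apply (continuous_Rmult f g)
  | |- continuous (fun y => - @?f y) _ => apply (continuous_opp (V := R_NormedModule) f)
  end; auto.

Lemma two_PI_pos : 0 < 2 * PI.
Proof. pose proof PI_RGT_0; lra. Qed.

Lemma ex_RInt_everywhere (f : R -> R) (a b : R) :
  (forall x, continuous f x) -> ex_RInt f a b.
Proof. intros H; apply (ex_RInt_continuous (V := R_CompleteNormedModule)); auto. Qed.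

Lemma is_derive_continuous (f : R -> R) (x l : R) : is_derive f x l -> continuous f x.
Proof. intros H; apply (ex_derive_continuous f x); now exists l. Qed.

Lemma derive_zero_constant (f : R -> R) :
  (forall x, is_derive f x 0) -> forall x y, f x = f y.
Proof.
  intros H.
  assert (L : forall x y, x < y -> f x = f y)
    by (intros x y; apply (eq_is_derive f x y); intros; apply H).
  intros x y; destruct (Rtotal_order x y) as [l|[->|l]]; auto. symmetry; auto.
Qed.

Lemma RInt_derive_periodic (Y y : R -> R) :
  periodic Y -> (forall x, is_derive Y x (y x)) -> (forall x, continuous y x) ->
  RInt y 0 (2 * PI) = 0.
Proof.
  intros HY Hy Hc. apply is_RInt_unique.
  replace 0 with (minus (Y (2 * PI)) (Y 0)) at 2.
  - apply (is_RInt_derive Y y); auto.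
  - rewrite <- (Rplus_0_l (2 * PI)), HY. apply (minus_eq_zero (Y 0)).
Qed.

Lemma periodic_derivative (f df : R -> R) :
  periodic f -> (forall x, is_derive f x (df x)) -> periodic df.
Proof.
  intros Hf Hd x.
  rewrite <- (is_derive_unique _ _ _ (Hd x)). symmetry; apply is_derive_unique.
  apply (is_derive_ext (fun y => f (y + 2 * PI))); [intros; apply Hf|].
  replace (df (x + 2 * PI)) with (scal 1 (df (x + 2 * PI))) by apply Rmult_1_l.
  apply (is_derive_comp f (fun y => y + 2 * PI)); [apply Hd|].
  auto_derive; [exact I | ring].
Qed.

Lemma RInt_positive (f : R -> R) :
  (forall x, continuous f x) -> (forall x, 0 < f x) -> 0 < RInt f 0 (2 * PI).
Proof. intros Hc Hp; apply RInt_gt_0; auto using two_PI_pos. Qed.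

Lemma RInt_plus_scal (f g : R -> R) (k : R) :
  (forall x, continuous f x) -> (forall x, continuous g x) ->
  RInt (fun x => f x + k * g x) 0 (2 * PI) =
  RInt f 0 (2 * PI) + k * RInt g 0 (2 * PI).
Proof.
  intros Cf Cg. apply is_RInt_unique.
  apply (is_RInt_plus f (fun x => scal k (g x))).
  - now apply (RInt_correct f), ex_RInt_everywhere.
  - now apply (is_RInt_scal g), (RInt_correct g), ex_RInt_everywhere.
Qed.

(** Derivatives of periodic functions integrate to zero, so they may be removed
    before estimating. All lower bounds on integrals below are obtained in this
    way: [Y] collects the oscillating terms, and [c] is a lower bound for what
    remains, the mean plus a small error. *)
Lemma RInt_neq_0_mod_periodic (k : R) (f Y y : R -> R) (c : R) :
  0 < c -> (forall x, continuous f x) -> periodic Y ->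
  (forall x, is_derive Y x (y x)) -> (forall x, continuous y x) ->
  (forall x, c <= k * f x - y x) -> RInt f 0 (2 * PI) <> 0.
Proof.
  intros Hc Cf HY Hy Cy Hb Ef.
  assert (Ckf : forall x, continuous (fun x => 0 + k * f x) x) by continuity.
  assert (Hp : 0 < RInt (fun x => 0 + k * f x + -1 * y x) 0 (2 * PI)).
  { apply RInt_positive; [continuity|]. intros x; specialize (Hb x); lra. }
  rewrite (RInt_plus_scal (fun x => 0 + k * f x)), (RInt_plus_scal (fun _ => 0)) in Hp
    by continuity.
  rewrite (RInt_derive_periodic Y y), Ef, (RInt_derive_periodic (fun _ => 0) (fun _ => 0)) in Hp;
    auto using continuous_const; [lra| |].
  - intros x; reflexivity.
  - intros x; apply (is_derive_const 0).
Qed.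

(** This is the equation [W' = phi - mean phi] in arc length, on a curve with
    speed [rho]. Subtracting the mean is what makes the primitive periodic, and
    the constant of integration is used to give [W] itself mean zero, so that
    the lemma can be applied to [W] again. *)
Lemma weighted_primitive (rho phi : R -> R) :
  (forall x, continuous rho x) -> (forall x, continuous phi x) ->
  periodic rho -> periodic phi -> (forall x, 0 < rho x) ->
  exists W : R -> R, periodic W /\
    (forall x, is_derive W x (rho x * (phi x -
       RInt (fun y => phi y * rho y) 0 (2 * PI) / RInt rho 0 (2 * PI)))) /\
    RInt (fun y => W y * rho y) 0 (2 * PI) = 0.
Proof.
  intros Cr Cp Pr Pp Hr.
  assert (HL := RInt_positive rho Cr Hr).
  set (L := RInt rho 0 (2 * PI) : R) in *.
  set (m := RInt (fun y => phi y * rho y) 0 (2 * PI) / L).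
  set (w := fun x => rho x * (phi x - m)).
  assert (Cw : forall x, continuous w x).
  { intros x; apply (continuous_mult rho (fun y => phi y - m)); auto.
    apply (continuous_minus phi); auto. apply continuous_const. }
  set (W0 := fun x => RInt w 0 x : R).
  assert (HW0 : forall x, is_derive W0 x (w x)).
  { intros x; apply (is_derive_RInt w W0 0); auto.
    apply filter_forall; intros y. apply (RInt_correct w), ex_RInt_everywhere, Cw. }
  assert (Iw : RInt w 0 (2 * PI) = 0).
  { transitivity (RInt (fun x => phi x * rho x + - m * rho x) 0 (2 * PI)).
    - apply RInt_ext; intros; unfold w; real_eq; ring.
    - rewrite (RInt_plus_scal (fun x => phi x * rho x)); auto.
      + fold L. unfold m. real_eq. field. lra.
      + intros; now apply (continuous_mult phi rho). }
  assert (PW0 : periodic W0).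
  { intros x.
    assert (D : forall z, is_derive (fun y => W0 (y + 2 * PI) - W0 y) z 0).
    { intros z. replace 0 with (minus (scal 1 (w (z + 2 * PI))) (w z)).
      - apply (is_derive_minus (fun y => W0 (y + 2 * PI)) W0); [|apply HW0].
        apply (is_derive_comp W0 (fun y => y + 2 * PI)); [apply HW0|].
        auto_derive; [exact I|ring].
      - unfold w. rewrite Pr, Pp.
        unfold minus, plus, opp, scal; simpl; unfold mult; simpl; ring. }
    generalize (derive_zero_constant _ D x 0). simpl.
    unfold W0 at 3 4. rewrite Rplus_0_l, Iw, RInt_point. unfold zero; simpl. lra. }
  set (a := RInt (fun y => W0 y * rho y) 0 (2 * PI) / L).
  exists (fun x => W0 x - a). split; [|split].
  - intros x; now rewrite PW0.
  - intros x. replace (_ * _) with (minus (w x) 0) by apply Rminus_0_r.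
    apply (is_derive_minus W0 (fun _ => a)); [apply HW0|apply (is_derive_const a)].
  - assert (CW : forall x, continuous W0 x) by (intros; eapply is_derive_continuous, HW0).
    transitivity (RInt (fun x => W0 x * rho x + - a * rho x) 0 (2 * PI)).
    + apply RInt_ext; intros; real_eq; ring.
    + rewrite (RInt_plus_scal (fun x => W0 x * rho x)); auto.
      * fold L. unfold a. real_eq. field. lra.
      * intros; now apply (continuous_mult W0 rho).
Qed.

(** * Existence of the potential *)

Lemma curve_int_speed (g : R -> plane) (rho f : R -> R) :
  (forall x, speed g x = rho x) ->
  curve_int g f = RInt (fun x => f x * rho x) 0 (2 * PI).
Proof. intros H; apply RInt_ext; intros; now rewrite H. Qed.

Lemma curve_mean_speed (g : R -> plane) (rho f : R -> R) :
  (forall x, speed g x = rho x) ->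
  curve_mean g f = RInt (fun x => f x * rho x) 0 (2 * PI) / RInt rho 0 (2 * PI).
Proof.
  intros H; unfold curve_mean. rewrite !(curve_int_speed g rho) by auto.
  f_equal. apply RInt_ext; intros; apply Rmult_1_l.
Qed.

(** Two successive integrations in arc length solve the Poisson equation: the
    first gives the derivative of the potential, whose mean vanishes, so that the
    second one gives a periodic function. *)
Lemma potential_exists (g V : R -> plane) (rho f : R -> R) :
  (forall x, speed g x = rho x) ->
  (forall x, dot (V x) (curvature_vector g x) = f x) ->
  (forall x, continuous rho x) -> (forall x, continuous f x) ->
  periodic rho -> periodic f -> (forall x, 0 < rho x) ->
  potential_spec g V (potential g V).
Proof.
  intros Hs Hf Cr Cf Pr Pf Hr. unfold potential; apply epsilon_spec.
  destruct (weighted_primitive rho f) as (w & Pw & Dw & Iw); auto.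
  assert (Cw : forall x, continuous w x) by (intros; eapply is_derive_continuous, Dw).
  destruct (weighted_primitive rho w) as (U & PU & DU & IU); auto.
  rewrite Iw in DU.
  assert (Eds : forall x, ds g U x = w x).
  { intros x; unfold ds. rewrite (is_derive_unique _ _ _ (DU x)), Hs. field.
    pose proof (Hr x); pose proof (RInt_positive rho Cr Hr); split; lra. }
  exists U. split; auto.
  - intros x; eexists; apply DU.
  - intros x; apply (ex_derive_ext w); [intros; now rewrite Eds|]. eexists; apply Dw.
  - intros x. unfold tangential_laplacian. unfold ds at 1.
    rewrite (Derive_ext _ w) by apply Eds.
    rewrite (is_derive_unique _ _ _ (Dw x)), Hs, (curve_mean_speed g rho) by auto.
    rewrite Hf, (RInt_ext (fun y => dot (V y) (curvature_vector g y) * rho y)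
      (fun y => f y * rho y)) by (intros; now rewrite Hf).
    field. pose proof (Hr x); pose proof (RInt_positive rho Cr Hr); split; lra.
  - rewrite (curve_mean_speed g rho), IU by auto. apply Rdiv_0_l.
Qed.

(** * Curves given by a support function *)

Lemma sin_periodic : periodic sin.
Proof. intros x. rewrite sin_plus, sin_2PI, cos_2PI. ring. Qed.

Lemma cos_periodic : periodic cos.
Proof. intros x. rewrite cos_plus, sin_2PI, cos_2PI. ring. Qed.

(** [h] is the support function of a convex curve as a function of the tangent
    angle, [dh] its derivative, and [rho = h + h''] the radius of curvature. *)
Record support_pair (h dh rho : R -> R) : Prop := {
  sp_smooth : smooth2 (fun _ x => h x);
  sp_smooth1 : smooth2 (fun _ x => dh x);
  sp_periodic : periodic h;
  sp_derive : forall x, is_derive h x (dh x);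
  sp_derive1 : forall x, is_derive dh x (rho x - h x);
  sp_continuous : forall x, continuous rho x;
  sp_pos : forall x, 0 < rho x
}.

(** The curve with support function [h], turned by the angle [a]. Its
    parametrization by the tangent angle makes all geometric quantities explicit:
    its velocity is [rho x * (cos (x + a), sin (x + a))]. *)
Definition support_curve (h dh : R -> R) (a x : R) : plane :=
  (h x * sin (x + a) + dh x * cos (x + a),
   dh x * sin (x + a) - h x * cos (x + a)).

Definition mkC2 (g : R -> plane) (Hg : embedding g) : C2 :=
  exist _ (fun p => exists x, g x = p) (ex_intro _ g (conj Hg (fun p => iff_refl _))).

Lemma mkC2_ext (g g' : R -> plane) (Hg : embedding g) (Hg' : embedding g') :
  (forall x, g x = g' x) -> mkC2 g Hg = mkC2 g' Hg'.
Proof.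
  intros E. apply functional_extensionality in E. subst g'.
  now rewrite (proof_irrelevance _ Hg Hg').
Qed.

Section SupportCurve.

Variables h dh rho : R -> R.
Hypothesis S : support_pair h dh rho.

Lemma sp_periodic1 : periodic dh.
Proof. apply (periodic_derivative h); apply S. Qed.

Lemma sp_periodic_rho : periodic rho.
Proof.
  intros x. generalize (periodic_derivative dh _ sp_periodic1 (sp_derive1 _ _ _ S) x).
  rewrite (sp_periodic _ _ _ S x). lra.
Qed.

Lemma sp_continuous_h (x : R) : continuous h x.
Proof. exact (is_derive_continuous h x _ (sp_derive _ _ _ S x)). Qed.

Lemma sp_continuous_dh (x : R) : continuous dh x.
Proof. exact (is_derive_continuous dh x _ (sp_derive1 _ _ _ S x)). Qed.

Lemma support_curve_derive_fst (a x : R) :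
  is_derive (fun y => fst (support_curve h dh a y)) x (rho x * cos (x + a)).
Proof.
  pose proof (sp_derive _ _ _ S x) as D. pose proof (sp_derive1 _ _ _ S x) as D1.
  simpl. auto_derive.
  - repeat split; eexists; eassumption.
  - rewrite (is_derive_unique (fun x : R => h x) x _ D).
    rewrite (is_derive_unique (fun x : R => dh x) x _ D1). ring.
Qed.

Lemma support_curve_derive_snd (a x : R) :
  is_derive (fun y => snd (support_curve h dh a y)) x (rho x * sin (x + a)).
Proof.
  pose proof (sp_derive _ _ _ S x) as D. pose proof (sp_derive1 _ _ _ S x) as D1.
  simpl. auto_derive.
  - repeat split; eexists; eassumption.
  - rewrite (is_derive_unique (fun x : R => h x) x _ D).
    rewrite (is_derive_unique (fun x : R => dh x) x _ D1). ring.
Qed.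

Lemma support_curve_derive (a x : R) :
  plane_derive (support_curve h dh a) x = scale (rho x) (cos (x + a), sin (x + a)).
Proof.
  unfold plane_derive, scale; simpl fst; simpl snd. f_equal; apply is_derive_unique.
  - apply support_curve_derive_fst.
  - apply support_curve_derive_snd.
Qed.

Lemma support_curve_speed (a x : R) : speed (support_curve h dh a) x = rho x.
Proof.
  unfold speed. rewrite support_curve_derive. unfold dot, scale; simpl.
  pose proof (sin2_cos2 (x + a)) as E. unfold Rsqr in E.
  replace (_ + _) with (rho x * rho x)
    by (transitivity (rho x * rho x * 1); [ring|rewrite <- E; ring]).
  apply sqrt_square, Rlt_le, S.
Qed.

Lemma support_curve_tangent (a x : R) :
  tangent (support_curve h dh a) x = (cos (x + a), sin (x + a)).
Proof.
  unfold tangent, plane_ds. rewrite support_curve_derive, support_curve_speed.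
  pose proof (sp_pos _ _ _ S x). unfold scale; simpl. f_equal; field; lra.
Qed.

Lemma support_curve_normal (a x : R) :
  normal (support_curve h dh a) x = (- sin (x + a), cos (x + a)).
Proof. unfold normal. now rewrite support_curve_tangent. Qed.

Lemma support_curve_curvature_vector (a x : R) :
  curvature_vector (support_curve h dh a) x = scale (/ rho x) (- sin (x + a), cos (x + a)).
Proof.
  unfold curvature_vector, plane_ds at 1. rewrite support_curve_speed. f_equal.
  unfold plane_derive. f_equal; apply is_derive_unique.
  - apply (is_derive_ext (fun y => cos (y + a))).
    + intros y. change (plane_ds _ _ y) with (tangent (support_curve h dh a) y).
      now rewrite support_curve_tangent.
    + auto_derive; [exact I | ring].
  - apply (is_derive_ext (fun y => sin (y + a))).
    + intros y. change (plane_ds _ _ y) with (tangent (support_curve h dh a) y).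
      now rewrite support_curve_tangent.
    + auto_derive; [exact I | ring].
Qed.

Lemma support_curve_curvature (a x : R) :
  curvature (support_curve h dh a) x = / rho x.
Proof.
  unfold curvature. rewrite support_curve_curvature_vector, support_curve_normal.
  pose proof (sin2_cos2 (x + a)) as E. unfold Rsqr in E. unfold dot, scale; simpl.
  transitivity (/ rho x * 1); [rewrite <- E; ring | ring].
Qed.

(** Along an arc that turns by at most [PI], the component of the velocity in the
    direction of the tangent at the middle angle is positive. *)
Lemma support_curve_arc_injective (a x y : R) :
  x < y -> y - x <= PI -> support_curve h dh a x <> support_curve h dh a y.
Proof.
  intros Hlt Hle E.
  set (m := (x + y) / 2 + a).
  set (p := fun z => cos m * fst (support_curve h dh a z) + sin m * snd (support_curve h dh a z)).
  assert (Dp : forall z, is_derive p z (rho z * cos (z + a - m))).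
  { intros z.
    replace (rho z * cos (z + a - m))
      with (plus (cos m * (rho z * cos (z + a))) (sin m * (rho z * sin (z + a))))
      by (rewrite cos_minus; unfold plus; simpl; ring).
    apply (is_derive_plus (fun z => cos m * fst (support_curve h dh a z))
      (fun z => sin m * snd (support_curve h dh a z))); apply is_derive_scal.
    - apply support_curve_derive_fst.
    - apply support_curve_derive_snd. }
  destruct (MVT_cor2 p (fun z => rho z * cos (z + a - m)) x y Hlt) as (z & Ez & Hz).
  { intros c _. apply is_derive_Reals, Dp. }
  assert (p x = p y) by (unfold p; now rewrite E).
  assert (0 < cos (z + a - m)) by (apply cos_gt_0; unfold m; lra).
  pose proof (sp_pos _ _ _ S z).
  assert (0 < rho z * cos (z + a - m) * (y - x))
    by (apply Rmult_lt_0_compat; [apply Rmult_lt_0_compat|]; lra).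
  lra.
Qed.

Lemma support_curve_periodic (a : R) : periodic (support_curve h dh a).
Proof.
  intros x. unfold support_curve. rewrite (sp_periodic _ _ _ S), sp_periodic1.
  replace (x + 2 * PI + a) with (x + a + 2 * PI) by ring.
  now rewrite sin_periodic, cos_periodic.
Qed.

Lemma support_curve_turn (a x : R) :
  support_curve h dh (a + 2 * PI) x = support_curve h dh a x.
Proof.
  unfold support_curve. replace (x + (a + 2 * PI)) with (x + a + 2 * PI) by ring.
  now rewrite sin_periodic, cos_periodic.
Qed.

(** The curve makes two full turns during the time interval [0,1], so that a
    full turn fits into its interior, where the derivative of the functional is
    two-sided. *)
Definition turning (t : R) : R -> plane := support_curve h dh (4 * PI * t).

Lemma turning_smooth_fst : smooth2 (fun t x => fst (turning t x)).
Proof.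
  replace (fun t x => fst (turning t x)) with
    (fun t x => h x * sin (4 * PI * t + 1 * x + 0) + dh x * cos (4 * PI * t + 1 * x + 0)).
  - apply smooth2_plus; apply smooth2_mult; try apply S;
      [apply smooth2_sin_affine | apply smooth2_cos_affine].
  - apply functional_extensionality; intro t. apply functional_extensionality; intro x.
    unfold turning, support_curve; simpl.
    now replace (4 * PI * t + 1 * x + 0) with (x + 4 * PI * t) by ring.
Qed.

Lemma turning_smooth_snd : smooth2 (fun t x => snd (turning t x)).
Proof.
  replace (fun t x => snd (turning t x)) with
    (fun t x => dh x * sin (4 * PI * t + 1 * x + 0) +
      h x * (-1 * cos (4 * PI * t + 1 * x + 0))).
  - apply smooth2_plus; repeat apply smooth2_mult; try apply S;
      [apply smooth2_sin_affine | apply smooth2_const | apply smooth2_cos_affine].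
  - apply functional_extensionality; intro t. apply functional_extensionality; intro x.
    unfold turning, support_curve; simpl.
    replace (4 * PI * t + 1 * x + 0) with (x + 4 * PI * t) by ring. ring.
Qed.

(** Two distinct points of the circle are joined by an arc of angle at most [PI],
    on one side or the other. *)
Lemma turning_embedding (t : R) : embedding (turning t).
Proof.
  split.
  - apply (smooth2_slice (fun t x => fst (turning t x))), turning_smooth_fst.
  - apply (smooth2_slice (fun t x => snd (turning t x))), turning_smooth_snd.
  - apply support_curve_periodic.
  - assert (L : forall x y, 0 <= x < 2 * PI -> 0 <= y < 2 * PI -> x < y ->
      turning t x <> turning t y).
    { intros x y Hx Hy Hlt E.
      destruct (Rle_dec (y - x) PI) as [Hle|Hgt].
      - exact (support_curve_arc_injective _ x y Hlt Hle E).
      - apply (support_curve_arc_injective (4 * PI * t) y (x + 2 * PI)); try lra.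
        rewrite support_curve_periodic. symmetry; exact E. }
    intros x y Hx Hy E. destruct (Rtotal_order x y) as [l|[l|l]]; auto.
    + now elim (L x y).
    + now elim (L y x).
  - intros x. unfold turning. rewrite support_curve_derive. unfold scale; simpl.
    intros [= E1 E2]. pose proof (sp_pos _ _ _ S x).
    apply Rmult_integral in E1 as [E1|E1]; [lra|].
    apply Rmult_integral in E2 as [E2|E2]; [lra|].
    now apply (cos_sin_0 (x + 4 * PI * t)).
Qed.

(** A rotation moves the curve with normal velocity [h'], the derivative of its
    support function. *)
Lemma turning_velocity (t x : R) :
  normal_velocity turning t x =
  scale (4 * PI * dh x) (- sin (x + 4 * PI * t), cos (x + 4 * PI * t)).
Proof.
  unfold normal_velocity. unfold turning at 2 3. rewrite support_curve_normal.
  set (n := (- sin (x + 4 * PI * t), cos (x + 4 * PI * t))).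
  replace (plane_derive (fun s => turning s x) t) with
    (4 * PI * (h x * cos (x + 4 * PI * t) - dh x * sin (x + 4 * PI * t)),
     4 * PI * (dh x * cos (x + 4 * PI * t) + h x * sin (x + 4 * PI * t))).
  - f_equal. unfold n, dot; simpl.
    pose proof (sin2_cos2 (x + 4 * PI * t)) as E. unfold Rsqr in E.
    transitivity (4 * PI * dh x * 1); [rewrite <- E; ring | ring].
  - unfold plane_derive, turning, support_curve; simpl.
    f_equal; symmetry; apply is_derive_unique; auto_derive; try exact I; ring.
Qed.

Definition turning_C2 (t : R) : C2 := mkC2 (turning t) (turning_embedding t).

Lemma turning_smooth_path : smooth_path turning_C2 turning.
Proof.
  split; intros.
  - apply turning_smooth_fst.
  - apply turning_smooth_snd.
  - apply turning_embedding.
  - intros p; apply iff_refl.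
Qed.

Lemma turning_loop (t : R) : turning_C2 (t + / 2) = turning_C2 t.
Proof.
  apply mkC2_ext. intros x. unfold turning.
  replace (4 * PI * (t + / 2)) with (4 * PI * t + 2 * PI) by field.
  apply support_curve_turn.
Qed.

(** Along a full turn the functional returns to its initial value, while its
    derivative is the constant [-c]. *)
Lemma gradient_orthogonal_to_turning inner rep X (F : C2 -> R) (c : R) :
  is_minus_gradient inner rep X F ->
  (forall t, inner (turning t) (X (turning t)) (rep (turning t) (normal_velocity turning t)) = c) ->
  c = 0.
Proof.
  intros HF Hc.
  assert (D : forall t, 0 < t < 1 -> derivable_pt_lim (fun s => F (turning_C2 s)) t (- c)).
  { intros t Ht eps Heps.
    destruct (HF turning_C2 turning turning_smooth_path t) with (eps := eps) as (d & Hd & H);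
      [lra|exact Heps|].
    assert (Hm : 0 < Rmin d (Rmin t (1 - t))) by (repeat apply Rmin_glb_lt; lra).
    exists (mkposreal _ Hm). simpl. intros k Hk Hkd.
    pose proof (Rmin_l d (Rmin t (1 - t))). pose proof (Rmin_r d (Rmin t (1 - t))).
    pose proof (Rmin_l t (1 - t)). pose proof (Rmin_r t (1 - t)).
    apply Rabs_def2 in Hkd as Hkd2.
    specialize (H (t + k)). simpl in H. unfold R_dist in H. rewrite Hc in H.
    replace (t + k - t) with k in H by ring. apply H.
    split; [split; [lra | lra] | lra]. }
  destruct (MVT_cor2 (fun s => F (turning_C2 s)) (fun _ => - c) (/ 4) (/ 4 + / 2)) as (z & Ez & _).
  - lra.
  - intros t Ht. apply D. lra.
  - simpl in Ez. rewrite turning_loop in Ez. lra.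
Qed.

(** * The two inner products with the rotation field *)

Lemma rho_inv_continuous (x : R) : continuous (fun y => / rho y) x.
Proof.
  apply (continuous_comp rho Rinv); [apply S|].
  apply continuity_pt_filterlim, continuity_pt_inv; [apply continuity_pt_id|].
  pose proof (sp_pos _ _ _ S x). unfold id; lra.
Qed.

Lemma turning_dot_curvature (t x : R) :
  dot (normal_velocity turning t x) (curvature_vector (turning t) x) = 4 * PI * dh x * / rho x.
Proof.
  rewrite turning_velocity. unfold turning. rewrite support_curve_curvature_vector.
  pose proof (sin2_cos2 (x + 4 * PI * t)) as E. unfold Rsqr in E.
  unfold dot, scale; simpl.
  transitivity (4 * PI * dh x * / rho x * 1); [rewrite <- E; ring | ring].
Qed.

Lemma curvature_dot_curvature (t x : R) :
  dot (curvature_vector (turning t) x) (curvature_vector (turning t) x) = / rho x * / rho x.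
Proof.
  unfold turning. rewrite support_curve_curvature_vector.
  pose proof (sin2_cos2 (x + 4 * PI * t)) as E. unfold Rsqr in E.
  unfold dot, scale; simpl.
  transitivity (/ rho x * / rho x * 1); [rewrite <- E; ring | ring].
Qed.

Lemma dot_comm (v w : plane) : dot v w = dot w v.
Proof. unfold dot; ring. Qed.

(** In the tangent angle the arc length element is [rho x dx] and the curvature
    is [1 / rho]. *)
Lemma inner_M_turning (t : R) :
  inner_M (turning t) (curvature_vector (turning t)) (normal_velocity turning t) =
  4 * PI * RInt (fun x => dh x * (1 + / rho x ^ 2)) 0 (2 * PI).
Proof.
  unfold inner_M. rewrite (curve_int_speed _ rho) by apply support_curve_speed.
  rewrite <- (RInt_scal (V := R_CompleteNormedModule)).
  - apply RInt_ext. intros x _. rewrite dot_comm, turning_dot_curvature.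
    unfold turning; rewrite support_curve_curvature.
    pose proof (sp_pos _ _ _ S x). unfold scal; simpl; unfold mult; simpl. real_eq. field. lra.
  - apply ex_RInt_everywhere. intros x. apply (continuous_mult dh).
    + apply sp_continuous_dh.
    + apply (continuous_plus (fun _ => 1)); [apply continuous_const|].
      apply (continuous_ext (fun y => / rho y * / rho y)).
      * intros y; pose proof (sp_pos _ _ _ S y). real_eq; field; lra.
      * apply (continuous_mult (fun y => / rho y)); apply rho_inv_continuous.
Qed.

Lemma potential_spec_solution (t : R) (V : R -> plane) (U f : R -> R) :
  potential_spec (turning t) V U ->
  (forall x, dot (V x) (curvature_vector (turning t) x) = f x) ->
  (forall x, is_derive U x (rho x * ds (turning t) U x)) /\
  (forall x, is_derive (ds (turning t) U) x
     (rho x * (f x - RInt (fun y => f y * rho y) 0 (2 * PI) / RInt rho 0 (2 * PI)))).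
Proof.
  intros HU Hf. split; intros x; pose proof (sp_pos _ _ _ S x) as Hr.
  - replace (rho x * ds (turning t) U x) with (Derive U x).
    + apply Derive_correct, HU.
    + unfold ds, turning. rewrite support_curve_speed. field. lra.
  - pose proof (pot_eq _ _ _ HU x) as E.
    rewrite (curve_mean_speed _ rho), Hf in E by apply support_curve_speed.
    rewrite (RInt_ext _ (fun y => f y * rho y)) in E by (intros; now rewrite Hf).
    unfold tangential_laplacian in E. unfold ds at 1 in E.
    rewrite (support_curve_speed _ x : speed (turning t) x = rho x) in E.
    replace (rho x * _) with (Derive (ds (turning t) U) x).
    + apply Derive_correct, HU.
    + transitivity (rho x * (Derive (ds (turning t) U) x / rho x)); [field; lra|].
      f_equal. lra.
Qed.

(** Let [w] and [u] be the arc length derivatives of the potentials of [H] and of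
    the rotation field. The normal parts contribute [4 PI h'], which integrates to
    zero. The tangential part of the rotation field is explicit:
    [u = 4 PI h + constant], since [u' = 4 PI h']. As [w] integrates to zero
    against [rho], its product with [u] has the integral of
    [4 PI w rho (h - k) = 4 PI w Q'], and an integration by parts moves the
    derivative to [w], where [w' = 1 / rho - m rho] removes the unknown potential;
    the constant [m] disappears as [Q] has weighted mean zero. *)
Lemma inner_N_turning (Q : R -> R) (k t : R) :
  periodic Q -> (forall x, is_derive Q x (rho x * (h x - k))) ->
  RInt (fun x => Q x * rho x) 0 (2 * PI) = 0 ->
  inner_N (turning t) (P (turning t) (curvature_vector (turning t)))
    (P (turning t) (normal_velocity turning t)) =
  - 4 * PI * RInt (fun x => Q x * / rho x) 0 (2 * PI) / RInt rho 0 (2 * PI).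
Proof.
  intros PQ DQ IQ.
  unfold inner_N. rewrite (curve_mean_speed _ rho) by apply support_curve_speed.
  f_equal.
  pose proof sp_periodic_rho as Pr.
  assert (Ph : periodic h) by apply S. pose proof sp_periodic1 as Pdh.
  assert (Cr : forall x, continuous rho x) by apply S.
  assert (Hr : forall x, 0 < rho x) by apply S.
  pose proof sp_continuous_h as Ch. pose proof sp_continuous_dh as Cdh.
  assert (CQ : forall x, continuous Q x) by (intros; eapply is_derive_continuous, DQ).
  pose proof rho_inv_continuous as Ci.
  assert (Cii : forall x, continuous (fun y => / rho y * / rho y) x)
    by (intros; now apply (continuous_mult (fun y => / rho y))).
  assert (C4 : forall x, continuous (fun y => 4 * PI * dh y) x)
    by (intros; now apply (continuous_scal_r (4 * PI) dh)).
  assert (Chi : forall x, continuous (fun y => 4 * PI * dh y * / rho y) x)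
    by (intros; now apply (continuous_mult (fun y => 4 * PI * dh y) (fun y => / rho y))).
  assert (SW := potential_exists (turning t) (curvature_vector (turning t)) rho
    (fun x => / rho x * / rho x) (support_curve_speed _) (curvature_dot_curvature t)
    Cr Cii Pr (fun x => ltac:(simpl; now rewrite Pr)) Hr).
  assert (SU := potential_exists (turning t) (normal_velocity turning t) rho
    (fun x => 4 * PI * dh x * / rho x) (support_curve_speed _) (turning_dot_curvature t)
    Cr Chi Pr (fun x => ltac:(simpl; now rewrite Pr, Pdh)) Hr).
  set (W := potential (turning t) (curvature_vector (turning t))) in *.
  set (U := potential (turning t) (normal_velocity turning t)) in *.
  destruct (potential_spec_solution _ _ _ _ SW (curvature_dot_curvature t)) as [DW Dw].
  destruct (potential_spec_solution _ _ _ _ SU (turning_dot_curvature t)) as [DU Du].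
  set (w := ds (turning t) W) in *. set (u := ds (turning t) U) in *.
  assert (Cw : forall x, continuous w x) by (intros; eapply is_derive_continuous, Dw).
  assert (Pw : periodic w).
  { intros x. pose proof (periodic_derivative W _ (pot_periodic _ _ _ SW) DW x) as E.
    simpl in E. rewrite Pr in E. apply Rmult_eq_reg_l with (rho x); auto. apply Rgt_not_eq, Hr. }
  set (m := RInt (fun y => / rho y * / rho y * rho y) 0 (2 * PI) / RInt rho 0 (2 * PI)) in *.
  assert (Z : RInt (fun y => 4 * PI * dh y * / rho y * rho y) 0 (2 * PI) = 0).
  { rewrite (RInt_ext _ (fun y => 4 * PI * dh y)).
    - apply (RInt_derive_periodic (fun y => 4 * PI * h y)); auto.
      + intros x; now rewrite Ph.
      + intros x; apply is_derive_scal, S.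
    - intros x _. pose proof (Hr x). real_eq; field; lra. }
  rewrite Z in Du.
  assert (Eu : forall x, u x = 4 * PI * h x + (u 0 - 4 * PI * h 0)).
  { assert (D : forall x, is_derive (fun y => u y - 4 * PI * h y) x 0).
    { intros x. replace 0 with
        (minus (rho x * (4 * PI * dh x * / rho x - 0 / RInt rho 0 (2 * PI))) (4 * PI * dh x)).
      - apply (is_derive_minus u); [apply Du|]. apply is_derive_scal, S.
      - pose proof (Hr x). pose proof (RInt_positive rho Cr Hr).
        unfold minus, plus, opp; simpl; real_eq; field; lra. }
    intros x. generalize (derive_zero_constant _ D x 0). simpl. lra. }
  set (c0 := u 0 - 4 * PI * h 0) in *.
  set (Y := fun x => 4 * PI * h x + (4 * PI * (w x * Q x) + (c0 + 4 * PI * k) * W x)).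
  set (y := fun x => 4 * PI * dh x +
    (4 * PI * (rho x * (/ rho x * / rho x - m) * Q x + w x * (rho x * (h x - k)))
     + (c0 + 4 * PI * k) * (rho x * w x))).
  assert (DY : forall x, is_derive Y x (y x)).
  { intros x. apply (is_derive_plus (fun x => 4 * PI * h x)); [apply is_derive_scal, S|].
    apply (is_derive_plus (fun x => 4 * PI * (w x * Q x))); apply is_derive_scal; [|apply DW].
    apply (is_derive_mult w Q); [apply Dw|apply DQ|apply Rmult_comm]. }
  assert (PY : periodic Y).
  { intros x. unfold Y. now rewrite Ph, Pw, PQ, (pot_periodic _ _ _ SW). }
  assert (Cy : forall x, continuous y x).
  { intros x. unfold y. continuity. }
  assert (CQr : forall x, continuous (fun y => Q y * rho y) x)
    by (intros; now apply (continuous_mult Q rho)).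
  assert (CQi : forall x, continuous (fun y => Q y * / rho y) x)
    by (intros; now apply (continuous_mult Q (fun y => / rho y))).
  transitivity (RInt (fun x => (y x + - (4 * PI) * (Q x * / rho x)) +
      (4 * PI * m) * (Q x * rho x)) 0 (2 * PI)).
  - apply RInt_ext. intros x _. real_eq.
    unfold P. rewrite turning_velocity. unfold tangential_gradient.
    fold W U. fold w u. rewrite Eu. unfold turning.
    rewrite support_curve_curvature_vector, support_curve_tangent.
    unfold dot, add, scale; simpl.
    pose proof (sin2_cos2 (x + 4 * PI * t)) as E. unfold Rsqr in E.
    set (s := sin (x + 4 * PI * t)) in *. set (c := cos (x + 4 * PI * t)) in *.
    transitivity ((/ rho x * (4 * PI * dh x) + w x * (4 * PI * h x + c0))
      * (s * s + c * c) * rho x).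
    + ring.
    + rewrite E. unfold y. pose proof (Hr x). field. lra.
  - rewrite (RInt_plus_scal (fun x => y x + - (4 * PI) * (Q x * / rho x))), (RInt_plus_scal y), IQ;
      auto.
    + rewrite (RInt_derive_periodic Y y) by auto. real_eq. ring.
    + intros x. apply (continuous_plus y); auto.
      now apply (continuous_scal_r (- (4 * PI)) (fun x => Q x * / rho x)).
Qed.

End SupportCurve.

(** * An explicit oval *)

(** A perturbation of the unit circle by the modes [cos 2x] and [sin 4x]. The
    first mode is absent because it only translates the curve. A curve with a mirror axis
    through the origin gives zero for both integrals, whence the mixture of a
    cosine and a sine. Two modes, one of them twice the other, make the leading
    terms of both integrals, which are cubic in the perturbation, nonzero.
    Everything is written in [cos (2 * x)] and [sin (2 * x)], so that identities
    become polynomial identities modulo [sin_mult_sin]. *)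
Definition oval_h (x : R) : R :=
  1 + (5 * cos (2 * x) + 2 * sin (2 * x) * cos (2 * x)) / 1000.
Definition oval_dh (x : R) : R :=
  (-10 * sin (2 * x) + 4 * (cos (2 * x) ^ 2 - sin (2 * x) ^ 2)) / 1000.
Definition oval_q (x : R) : R :=
  - 15 * (cos (2 * x) + 2 * sin (2 * x) * cos (2 * x)) / 1000.
Definition oval_rho (x : R) : R := 1 + oval_q x.

Lemma sin_mult_sin (y : R) : sin y * sin y = 1 - cos y * cos y.
Proof. pose proof (sin2_cos2 y) as E. unfold Rsqr in E. lra. Qed.

Ltac double_angle x :=
  let E := fresh "Hs" in
  pose proof (sin_mult_sin (2 * x)) as E;
  pose proof (COS_bound (2 * x)); pose proof (SIN_bound (2 * x));
  set (c := cos (2 * x)) in *; set (s := sin (2 * x)) in *.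

Lemma oval_q_bound (x : R) : Rabs (oval_q x) <= 3 / 100.
Proof.
  unfold oval_q. double_angle x.
  assert (-1 <= 2 * s * c <= 1)
    by (pose proof (Rle_0_sqr (s - c)); pose proof (Rle_0_sqr (s + c)); unfold Rsqr in *; lra).
  apply Rabs_le; lra.
Qed.

Lemma oval_rho_bound (x : R) : 97 / 100 <= oval_rho x.
Proof. pose proof (oval_q_bound x) as H. apply Rabs_le_between in H. unfold oval_rho; lra. Qed.

Lemma cos_double_periodic (x : R) : cos (2 * (x + 2 * PI)) = cos (2 * x).
Proof.
  replace (2 * (x + 2 * PI)) with (2 * x + 2 * PI + 2 * PI) by ring.
  now rewrite !cos_periodic.
Qed.

Lemma sin_double_periodic (x : R) : sin (2 * (x + 2 * PI)) = sin (2 * x).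
Proof.
  replace (2 * (x + 2 * PI)) with (2 * x + 2 * PI + 2 * PI) by ring.
  now rewrite !sin_periodic.
Qed.

Lemma oval_support_pair : support_pair oval_h oval_dh oval_rho.
Proof.
  assert (Hc := smooth2_cos_affine 0 2 0). assert (Hs := smooth2_sin_affine 0 2 0).
  assert (E : forall t x, 0 * t + 2 * x + 0 = 2 * x) by (intros; ring).
  split.
  - replace (fun _ x => oval_h x : R) with (fun t x : R =>
      1 + (/ 1000) * (5 * cos (0 * t + 2 * x + 0) +
        2 * (sin (0 * t + 2 * x + 0) * cos (0 * t + 2 * x + 0)))).
    + repeat (apply smooth2_plus || apply smooth2_mult); auto using smooth2_const.
    + apply functional_extensionality; intro t. apply functional_extensionality; intro x.
      rewrite !E. unfold oval_h. field.
  - replace (fun _ x => oval_dh x : R) with (fun t x : R =>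
      (/ 1000) * (-10 * sin (0 * t + 2 * x + 0) +
        4 * (cos (0 * t + 2 * x + 0) * cos (0 * t + 2 * x + 0) +
          -1 * (sin (0 * t + 2 * x + 0) * sin (0 * t + 2 * x + 0))))).
    + repeat (apply smooth2_plus || apply smooth2_mult); auto using smooth2_const.
    + apply functional_extensionality; intro t. apply functional_extensionality; intro x.
      rewrite !E. unfold oval_dh. field.
  - intros x. unfold oval_h. now rewrite cos_double_periodic, sin_double_periodic.
  - intros x. unfold oval_h, oval_dh. auto_derive; [exact I|field].
  - intros x. unfold oval_dh, oval_rho, oval_q, oval_h. auto_derive; [exact I|field].
  - intros x. eapply is_derive_continuous. unfold oval_rho, oval_q.
    auto_derive; [exact I|reflexivity].
  - intros x. pose proof (oval_rho_bound x). lra.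
Qed.

Lemma Rabs_mult_le (a b A B : R) : Rabs a <= A -> Rabs b <= B -> Rabs (a * b) <= A * B.
Proof. intros; rewrite Rabs_mult; apply Rmult_le_compat; auto using Rabs_pos. Qed.

Lemma oval_inv_rho_bound (x : R) : Rabs (/ oval_rho x) <= 104 / 100.
Proof.
  pose proof (oval_rho_bound x).
  rewrite Rabs_pos_eq by (apply Rlt_le, Rinv_0_lt_compat; lra).
  replace (104 / 100) with (/ (100 / 104)) by field. apply Rinv_le_contravar; lra.
Qed.

Lemma oval_dh_bound (x : R) : Rabs (oval_dh x) <= 14 / 1000.
Proof.
  unfold oval_dh. double_angle x.
  assert (0 <= c * c) by apply Rle_0_sqr. assert (0 <= s * s) by apply Rle_0_sqr.
  apply Rabs_le; simpl; lra.
Qed.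

(** The trigonometric polynomial [3 h' q^2] has the mean [-27/10^7]; this is the
    primitive of its oscillating part, read off from the Fourier expansion. *)
Definition oval_M_prim (x : R) : R :=
  let c := cos (2 * x) in let s := sin (2 * x) in
  (1485 * c ^ 3 - 972 * c ^ 5 - 270 * s * c + 1170 * s * c ^ 3 - 360 * s * c ^ 5) / 200000000.

Lemma oval_M_prim_derive (x : R) :
  is_derive oval_M_prim x (3 * oval_dh x * oval_q x ^ 2 + 27 / 10000000).
Proof.
  unfold oval_M_prim, oval_dh, oval_q. auto_derive; [exact I|]. double_angle x.
  field [Hs].
Qed.

(** With [rho = 1 + q], one has
    [1 / rho^2 = 3 - 2 rho + 3 q^2 - (4 q^3 + 3 q^4) / rho^2]. The term
    [h' (4 - 2 rho)] is exactly the derivative of [4 h - h^2 - h'^2], so the mean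
    of [3 h' q^2] decides the sign, the last term being of fourth order. *)
Lemma oval_M_integral_neq_0 :
  RInt (fun x => oval_dh x * (1 + / oval_rho x ^ 2)) 0 (2 * PI) <> 0.
Proof.
  set (h := oval_h). set (dh := oval_dh). set (rho := oval_rho). set (q := oval_q).
  assert (S := oval_support_pair).
  assert (Dh : forall x, is_derive h x (dh x)) by apply S.
  assert (Ddh : forall x, is_derive dh x (rho x - h x)) by apply S.
  assert (Ch : forall x, continuous h x) by (intros; eapply is_derive_continuous, Dh).
  assert (Cdh : forall x, continuous dh x) by (intros; eapply is_derive_continuous, Ddh).
  assert (Cr : forall x, continuous rho x) by apply S.
  assert (Cq : forall x, continuous q x).
  { intros x. unfold q, oval_q. eapply is_derive_continuous. auto_derive; [exact I|reflexivity]. }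
  assert (Ci := rho_inv_continuous _ _ _ S).
  apply (RInt_neq_0_mod_periodic (-1) _ (fun x => h x * h x + dh x * dh x - 4 * h x - oval_M_prim x)
    (fun x => dh x * (2 * rho x - 4) - (3 * dh x * q x ^ 2 + 27 / 10000000)) (/ 1000000)).
  - lra.
  - intros x. apply (continuous_ext (fun x => dh x * (1 + / rho x * / rho x))).
    + intros y. pose proof (oval_rho_bound y). fold rho in H. real_eq. field. lra.
    + continuity.
  - intros x. unfold h, dh, oval_h, oval_dh, oval_M_prim.
    now rewrite cos_double_periodic, sin_double_periodic.
  - intros x.
    replace (dh x * (2 * rho x - 4) - (3 * dh x * q x ^ 2 + 27 / 10000000)) with
      ((dh x * h x + h x * dh x) + ((rho x - h x) * dh x + dh x * (rho x - h x)) - 4 * dh x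
       - (3 * dh x * q x ^ 2 + 27 / 10000000)) by ring.
    apply (is_derive_minus (fun x => h x * h x + dh x * dh x - 4 * h x) oval_M_prim);
      [|apply oval_M_prim_derive].
    apply (is_derive_minus (fun x => h x * h x + dh x * dh x) (fun x => 4 * h x));
      [|now apply is_derive_scal].
    apply (is_derive_plus (fun x => h x * h x) (fun x => dh x * dh x));
      [apply (is_derive_mult h h)|apply (is_derive_mult dh dh)]; auto using Rmult_comm.
  - intros x; simpl pow. continuity.
  - intros x.
    replace (-1 * (dh x * (1 + / rho x ^ 2)) - _) with
      (27 / 10000000 + dh x * (q x * (q x * (q x * (4 + 3 * q x)))) * (/ rho x * / rho x)).
    + assert (B1 : Rabs (4 + 3 * q x) <= 41 / 10).
      { pose proof (oval_q_bound x) as B. apply Rabs_le_between in B. apply Rabs_le.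
        fold q in B. lra. }
      assert (B := Rabs_mult_le _ _ _ _ (Rabs_mult_le _ _ _ _ (oval_dh_bound x)
        (Rabs_mult_le _ _ _ _ (oval_q_bound x) (Rabs_mult_le _ _ _ _ (oval_q_bound x)
           (Rabs_mult_le _ _ _ _ (oval_q_bound x) B1))))
        (Rabs_mult_le _ _ _ _ (oval_inv_rho_bound x) (oval_inv_rho_bound x))).
      fold q dh rho in B. apply Rabs_le_between in B. lra.
    + pose proof (oval_rho_bound x). unfold rho, oval_rho in *. fold q. fold q in H.
      field. lra.
Qed.

(** The function [Q] of [inner_N_turning] for this oval. The constant
    [k = 199991/200000] is the mean of [rho h], and the constant term of [oval_Q]
    is fixed by the orthogonality, shown by the periodic primitive
    [oval_Q_rho_prim] of [Q rho]. *)
Definition oval_Q (x : R) : R :=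
  let c := cos (2 * x) in let s := sin (2 * x) in
  (159955 - 319784 * c ^ 2 + 19200 * c ^ 3 + 1599784 * s - 14400 * s * c + 4800 * s * c ^ 3)
  / 640000000.

Lemma oval_Q_derive (x : R) :
  is_derive oval_Q x (oval_rho x * (oval_h x - 199991 / 200000)).
Proof.
  unfold oval_Q, oval_rho, oval_q, oval_h. auto_derive; [exact I|]. double_angle x.
  field [Hs].
Qed.

Definition oval_Q_rho_prim (x : R) : R :=
  let c := cos (2 * x) in let s := sin (2 * x) in
  (-319956800 * c + 4319541 * c ^ 2 - 14400 * c ^ 3 - 719676 * c ^ 4 + 25920 * c ^ 5
   - 479865 * s - 31991000 * s * c + 4799352 * s * c ^ 2 - 37200 * s * c ^ 3 + 4800 * s * c ^ 5)
  / 256000000000.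

Lemma oval_Q_rho_prim_derive (x : R) : is_derive oval_Q_rho_prim x (oval_Q x * oval_rho x).
Proof.
  unfold oval_Q_rho_prim, oval_Q, oval_rho, oval_q. auto_derive; [exact I|]. double_angle x.
  field [Hs].
Qed.

(** The mean [63/640000000] of [oval_Q] is of third order, although [oval_Q]
    itself is of first order. *)
Definition oval_Q_prim (x : R) : R :=
  let c := cos (2 * x) in let s := sin (2 * x) in
  (-799892 * c + 3600 * c ^ 2 - 600 * c ^ 4 + 6400 * s - 79946 * s * c + 3200 * s * c ^ 2)
  / 640000000.

Lemma oval_Q_prim_derive (x : R) : is_derive oval_Q_prim x (oval_Q x - 63 / 640000000).
Proof.
  unfold oval_Q_prim, oval_Q. auto_derive; [exact I|]. double_angle x.
  field [Hs].
Qed.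

(** The part of [oval_Q] of first order in the perturbation. It suffices in the
    product with [q^2], whose mean is then [4275/(16 * 10^9)] up to terms of
    fourth order. *)
Definition oval_Q1 (x : R) : R :=
  let c := cos (2 * x) in let s := sin (2 * x) in (10 * s - (c ^ 2 - s ^ 2)) / 4000.

Definition oval_Q1_prim (x : R) : R :=
  let c := cos (2 * x) in let s := sin (2 * x) in
  (-3240 * c ^ 3 + 1728 * c ^ 5 + 855 * s * c - 2130 * s * c ^ 3 + 240 * s * c ^ 5) / 6400000000.

Lemma oval_Q1_prim_derive (x : R) :
  is_derive oval_Q1_prim x (oval_Q1 x * oval_q x ^ 2 - 4275 / 16000000000).
Proof.
  unfold oval_Q1_prim, oval_Q1, oval_q. auto_derive; [exact I|]. double_angle x.
  field [Hs].
Qed.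

Lemma oval_Q_bounds (x : R) :
  Rabs (oval_Q x) <= 4 / 1000 /\ Rabs (oval_Q x - oval_Q1 x) <= 1 / 10000.
Proof.
  unfold oval_Q, oval_Q1. double_angle x.
  assert (Bc : Rabs c <= 1) by (apply Rabs_le; lra).
  assert (Bs : Rabs s <= 1) by (apply Rabs_le; lra).
  assert (Bcc := Rabs_mult_le _ _ _ _ Bc Bc).
  assert (Bccc := Rabs_mult_le _ _ _ _ Bc Bcc).
  assert (Bsc := Rabs_mult_le _ _ _ _ Bs Bc).
  assert (Bsccc := Rabs_mult_le _ _ _ _ Bs Bccc).
  apply Rabs_le_between in Bcc, Bccc, Bsc, Bsccc.
  simpl pow. rewrite !Rmult_1_r, !(Rmult_assoc _ s), Hs.
  split; apply Rabs_le; lra.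
Qed.

(** Here [1 / rho = 2 - rho + q^2 - q^3 / rho]. The integral of [Q rho] vanishes,
    the means of [2 Q] and of [Q1 q^2] are both positive and of third order, and
    [(Q - Q1) q^2] and [Q q^3 / rho] are of fourth order. *)
Lemma oval_N_integral_neq_0 : RInt (fun x => oval_Q x * / oval_rho x) 0 (2 * PI) <> 0.
Proof.
  assert (S := oval_support_pair).
  assert (CQ : forall x, continuous oval_Q x)
    by (intros; eapply is_derive_continuous, oval_Q_derive).
  assert (Cr : forall x, continuous oval_rho x) by apply S.
  assert (Cq : forall x, continuous oval_q x).
  { intros x. unfold oval_q. eapply is_derive_continuous. auto_derive; [exact I|reflexivity]. }
  assert (CQ1 : forall x, continuous oval_Q1 x).
  { intros x. unfold oval_Q1. eapply is_derive_continuous. auto_derive; [exact I|reflexivity]. }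
  assert (Ci := rho_inv_continuous _ _ _ S).
  apply (RInt_neq_0_mod_periodic 1 _
    (fun x => 2 * oval_Q_prim x - oval_Q_rho_prim x + oval_Q1_prim x)
    (fun x => 2 * (oval_Q x - 63 / 640000000) - oval_Q x * oval_rho x
      + (oval_Q1 x * oval_q x ^ 2 - 4275 / 16000000000)) (/ 10000000)).
  - lra.
  - intros x. continuity.
  - intros x. unfold oval_Q_prim, oval_Q_rho_prim, oval_Q1_prim.
    now rewrite cos_double_periodic, sin_double_periodic.
  - intros x.
    apply (is_derive_plus (fun x => 2 * oval_Q_prim x - oval_Q_rho_prim x) oval_Q1_prim);
      [|apply oval_Q1_prim_derive].
    apply (is_derive_minus (fun x => 2 * oval_Q_prim x) oval_Q_rho_prim);
      [|apply oval_Q_rho_prim_derive].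
    apply is_derive_scal, oval_Q_prim_derive.
  - intros x. simpl pow. continuity.
  - intros x. destruct (oval_Q_bounds x) as [B0 B1].
    assert (Bq := oval_q_bound x). assert (Bqq := Rabs_mult_le _ _ _ _ Bq Bq).
    assert (E1 := Rabs_mult_le _ _ _ _ B1 Bqq).
    assert (E2 := Rabs_mult_le _ _ _ _ B0 (Rabs_mult_le _ _ _ _ (Rabs_mult_le _ _ _ _ Bq Bqq)
      (oval_inv_rho_bound x))).
    apply Rabs_le_between in E1, E2.
    replace (oval_Q x * / oval_rho x) with
      (2 * oval_Q x - oval_Q x * oval_rho x + oval_Q x * (oval_q x * oval_q x)
       - oval_Q x * (oval_q x * (oval_q x * oval_q x) * / oval_rho x)).
    + simpl pow. lra.
    + pose proof (oval_rho_bound x) as H. unfold oval_rho in *. field. lra.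
Qed.

Theorem theorem1p1 :
  (~ exists F : C2 -> R,
      is_minus_gradient inner_N P (fun g => P g (curvature_vector g)) F) /\
  (~ exists F : C2 -> R,
      is_minus_gradient inner_M (fun _ V => V) curvature_vector F).
Proof.
  assert (S := oval_support_pair). pose proof PI_RGT_0 as Hpi.
  split; intros [F HF].
  - assert (PQ : periodic oval_Q).
    { intros x. unfold oval_Q. now rewrite cos_double_periodic, sin_double_periodic. }
    assert (IQ : RInt (fun x => oval_Q x * oval_rho x) 0 (2 * PI) = 0).
    { apply (RInt_derive_periodic oval_Q_rho_prim).
      - intros x. unfold oval_Q_rho_prim.
        now rewrite cos_double_periodic, sin_double_periodic.
      - apply oval_Q_rho_prim_derive.
      - intros x. apply continuous_Rmult; [|apply S].
        exact (is_derive_continuous _ _ _ (oval_Q_derive x)). }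
    assert (E := gradient_orthogonal_to_turning _ _ _ S _ _ _ F _ HF (fun t =>
      inner_N_turning _ _ _ S oval_Q _ t PQ oval_Q_derive IQ)).
    assert (HL : 0 < RInt oval_rho 0 (2 * PI)) by (apply RInt_positive; apply S).
    apply oval_N_integral_neq_0.
    apply Rmult_integral in E as [E|E].
    + apply Rmult_integral in E as [E|E]; [lra|exact E].
    + pose proof (Rinv_0_lt_compat _ HL). lra.
  - assert (E := gradient_orthogonal_to_turning _ _ _ S _ _ _ F _ HF (inner_M_turning _ _ _ S)).
    apply oval_M_integral_neq_0.
    apply Rmult_integral in E as [E|E]; [lra|exact E].
Qed.
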